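(* Let $M,N\ge1$ be integers, $P,\sigma^2,\beta_1,\beta_2,\beta_3,\alpha_{\rm A\text{-}RIS},\alpha_{\rm NCR}>0$, $\varphi_1\in\mathbb{R}$, let $\mathbf{a}_{2,1}\in\mathbb{C}^M$ have unit-modulus entries, and let $\mathbf{h}_3\sim\mathcal{CN}(\mathbf{0},\mathbf{R}_3)$ be a random vector in $\mathbb{C}^M$ with $\mathrm{tr}(\mathbf{R}_3)=M\beta_3$. Put $x=\mathbf{h}_3^{H}\mathbf{a}_{2,1}e^{\mathsf{j}\varphi_1}$ and $$\mathrm{SNR}_{\rm P\text{-}RIS}=\frac{P}{\sigma^2}\left(\|\mathbf{h}_3\|^2+\beta_1\beta_2N^2M+2\sqrt{\beta_1\beta_2}\,N\,\Re(x)\right),$$ $$\mathrm{SNR}_{\rm A\text{-}RIS}=\frac{P\alpha_{\rm A\text{-}RIS}^2M\beta_1\beta_2N^2-P\alpha_{\rm A\text{-}RIS}^2\beta_2N|x|^2+2P\alpha_{\rm A\text{-}RIS}N\sqrt{\beta_1\beta_2}\,\Re(x)}{\sigma^2(1+\alpha_{\rm A\text{-}RIS}^2\beta_2MN)}+\frac{P\|\mathbf{h}_3\|^2}{\sigma^2},$$ $$\mathrm{SNR}_{\rm NCR}=\frac{P\alpha_{\rm NCR}^2M\beta_1\beta_2-P\alpha_{\rm NCR}^2\beta_2|x|^2+2P\alpha_{\rm NCR}\sqrt{\beta_1\beta_2}\,\Re(x)}{\sigma^2(1+\alpha_{\rm NCR}^2\beta_2M)}+\frac{P\|\mathbf{h}_3\|^2}{\sigma^2}.$$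 Then the average SNRs (expectations over $\mathbf{h}_3$) are $$\overline{\mathrm{SNR}}_{\rm P\text{-}RIS}=\frac{P\left(\beta_3M+\beta_1\beta_2N^2M\right)}{\sigma^2},$$ $$\overline{\mathrm{SNR}}_{\rm A\text{-}RIS}=\frac{P\alpha_{\rm A\text{-}RIS}^2M\beta_1\beta_2N^2-P\alpha_{\rm A\text{-}RIS}^2\beta_2N\,\mathbf{a}_{2,1}^{H}\mathbf{R}_3\mathbf{a}_{2,1}}{\sigma^2(1+\alpha_{\rm A\text{-}RIS}^2\beta_2MN)}+\frac{P\beta_3M}{\sigma^2},$$ $$\overline{\mathrm{SNR}}_{\rm NCR}=\frac{P\alpha_{\rm NCR}^2M\beta_1\beta_2-P\alpha_{\rm NCR}^2\beta_2\,\mathbf{a}_{2,1}^{H}\mathbf{R}_3\mathbf{a}_{2,1}}{\sigma^2(1+\alpha_{\rm NCR}^2\beta_2M)}+\frac{P\beta_3M}{\sigma^2}.$$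
   Context: $\mathsf{j}$ is the imaginary unit, $(\cdot)^H$ the conjugate transpose, $\Re$ the real part, $\|\cdot\|$ the Euclidean norm, and $\mathcal{CN}(\mathbf{0},\mathbf{R}_3)$ the circularly symmetric complex Gaussian distribution with positive semidefinite covariance $\mathbf{R}_3$. The setting is a wideband uplink in which the direct channel $\mathbf{h}_3$ varies randomly over subcarriers while the RIS phases/amplitudes and repeater gain are common to all subcarriers; hence the direct and cascaded paths are in general not phase-aligned on a given subcarrier, which is why $\Re(x)$ appears in the per-subcarrier SNRs of the passive RIS, the active RIS (common element amplitude $\alpha_{\rm A\text{-}RIS}$) and the network-controlled repeater (NCR, gain $\alpha_{\rm NCR}$). *)

(* Defs.v *)
From HB Require Import structures.
From mathcomp Require Import all_boot all_order all_algebra.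
From mathcomp Require Import all_classical all_reals all_analysis.
From mathcomp Require Import complex.

Set Implicit Arguments.
Unset Strict Implicit.
Unset Printing Implicit Defensive.

Import Order.TTheory GRing.Theory Num.Theory.
Import numFieldNormedType.Exports.

Local Open Scope classical_set_scope.
Local Open Scope ring_scope.
Local Open Scope complex_scope.
Local Open Scope sesquilinear_scope.

Definition hform (R : realType) n (A : 'M[R[i]]_n) (v : 'cV[R[i]]_n) : R[i] :=
  (v ^t* *m A *m v) 0 0.

Definition psdmx (R : realType) n (A : 'M[R[i]]_n) : Prop :=
  A \is hermsymmx /\ forall v : 'cV[R[i]]_n, 0 <= hform A v.

(* For a positive semidefinite A the scalar v^H A v is real, so that taking
   its real part loses nothing. *)
Lemma psdmx_hform_real (R : realType) n (A : 'M[R[i]]_n) (v : 'cV[R[i]]_n) :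
  psdmx A -> hform A v = (complex.Re (hform A v))%:C.
Proof.
by case=> _ /(_ v); case: (hform A v) => a b; rewrite lecE /= => /andP[/eqP-> _].
Qed.

(* The univariate law N(m, v). The case v = 0 is separated because
   normal_prob m 0 is not the Dirac mass at m. *)
Definition gaussian_law (R : realType) (m v : R) : set R -> \bar R :=
  if v == 0 then \d_m else normal_prob m (Num.sqrt v).

(* X ~ N(mu, Sigma), Sigma possibly singular: every linear form c^T X has the
   law N(c^T mu, c^T Sigma c). *)
Definition normal_vector d (T : measurableType d) (R : realType)
    (Pr : probability T R) n (X : T -> 'cV[R]_n)
    (mu : 'cV[R]_n) (Sigma : 'M[R]_n) : Prop :=
  (forall i, measurable_fun [set: T] (fun w => X w i 0)) /\
  forall (c : 'cV[R]_n) (A : set R), measurable A ->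
    pushforward Pr (fun w => (c^T *m X w) 0 0) A =
    gaussian_law ((c^T *m mu) 0 0) ((c^T *m Sigma *m c) 0 0) A.

(* h ~ CN(0, C): the stacked real vector (Re h, Im h) is centered Gaussian.
   The block form of its covariance encodes both E[h h^H] = C and circular
   symmetry, E[h h^T] = 0. *)
Definition circular_complex_normal d (T : measurableType d) (R : realType)
    (Pr : probability T R) n (h : T -> 'cV[R[i]]_n) (C : 'M[R[i]]_n) : Prop :=
  let ReC := map_mx (@complex.Re R) C in
  let ImC := map_mx (@complex.Im R) C in
  normal_vector Pr
    (fun w => col_mx (map_mx (@complex.Re R) (h w))
                     (map_mx (@complex.Im R) (h w)))
    0 (2^-1 *: block_mx ReC (- ImC) ImC ReC).

Definition enorm (R : realType) n (v : 'cV[R[i]]_n) : R :=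
  Num.sqrt (\sum_i Normc.normc (v i 0) ^+ 2).

Definition expj (R : realType) (t : R) : R[i] := cos t +i* sin t.

Definition cross_gain (R : realType) M (a21 : 'cV[R[i]]_M) (phi1 : R)
    (h3 : 'cV[R[i]]_M) : R[i] :=
  (h3 ^t* *m a21) 0 0 * expj phi1.

Definition SNR_PRIS (R : realType) M (N : nat) (P sigma beta1 beta2 phi1 : R)
    (a21 h3 : 'cV[R[i]]_M) : R :=
  let x := cross_gain a21 phi1 h3 in
  P / sigma ^+ 2 *
  (enorm h3 ^+ 2 + beta1 * beta2 * N%:R ^+ 2 * M%:R
   + 2 * Num.sqrt (beta1 * beta2) * N%:R * complex.Re x).

Definition SNR_ARIS (R : realType) M (N : nat)
    (P sigma beta1 beta2 alpha phi1 : R) (a21 h3 : 'cV[R[i]]_M) : R :=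
  let x := cross_gain a21 phi1 h3 in
  (P * alpha ^+ 2 * M%:R * beta1 * beta2 * N%:R ^+ 2
   - P * alpha ^+ 2 * beta2 * N%:R * Normc.normc x ^+ 2
   + 2 * P * alpha * N%:R * Num.sqrt (beta1 * beta2) * complex.Re x)
  / (sigma ^+ 2 * (1 + alpha ^+ 2 * beta2 * M%:R * N%:R))
  + P * enorm h3 ^+ 2 / sigma ^+ 2.

Definition SNR_NCR (R : realType) M
    (P sigma beta1 beta2 alpha phi1 : R) (a21 h3 : 'cV[R[i]]_M) : R :=
  let x := cross_gain a21 phi1 h3 in
  (P * alpha ^+ 2 * M%:R * beta1 * beta2
   - P * alpha ^+ 2 * beta2 * Normc.normc x ^+ 2
   + 2 * P * alpha * Num.sqrt (beta1 * beta2) * complex.Re x)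
  / (sigma ^+ 2 * (1 + alpha ^+ 2 * beta2 * M%:R))
  + P * enorm h3 ^+ 2 / sigma ^+ 2.

(* Main.v *)
(* For every b the scalar Re(h3^H b) is a linear form of the stacked real vector
   (Re h3, Im h3), hence has the law N(0, Re(b^H R3 b) / 2). It is centered by
   symmetry, and Im(h3^H b) = Re(h3^H (-i b)) has the same law, so that
   E|h3^H b|^2 = Re(b^H R3 b). Taking b = e^(j phi1) a21 gives the moments of x,
   and summing over the canonical basis gives E|h3|^2 = tr R3; each SNR is an
   affine combination of Re x, |x|^2 and |h3|^2. *)

Require Import Defs.
From HB Require Import structures.
From mathcomp Require Import all_boot all_order all_algebra.
From mathcomp Require Import all_classical all_reals all_analysis.
From mathcomp Require Import complex.
From mathcomp Require Import measurable_realfun.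
From mathcomp Require Import ring lra.

Set Implicit Arguments.
Unset Strict Implicit.

Import Order.TTheory GRing.Theory Num.Theory.
Import numFieldNormedType.Exports.

Local Open Scope classical_set_scope.
Local Open Scope ring_scope.
Local Open Scope complex_scope.

(** * Integration against a measure given by a density *)

Section density.
Import HBNNSimple.
Local Open Scope ereal_scope.

(** Monotone convergence along simple functions increasing to [f] reduces the identity to
    indicators, where it is the hypothesis on [nu]. *)
Lemma ge0_integral_density d (T : measurableType d) (R : realType)
    (mu nu : {measure set T -> \bar R}) (p : T -> R) (f : T -> \bar R) :
  measurable_fun setT p -> (forall x, 0 <= p x)%R ->
  (forall A, measurable A -> nu A = \int[mu]_(x in A) (p x)%:E) ->
  measurable_fun setT f -> (forall x, 0 <= f x) ->
  \int[nu]_x f x = \int[mu]_x (f x * (p x)%:E).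
Proof.
move=> mp p0 nuE mf f0.
pose f_ := nnsfun_approx measurableT mf.
have cf_ x : EFin \o f_^~ x @ \oo --> f x.
  by apply: cvg_nnsfun_approx => // y _; exact: f0.
transitivity (limn (fun n => \int[nu]_x (f_ n x)%:E)).
  rewrite -monotone_convergence//.
  - by apply: eq_integral => y _; apply/esym/cvg_lim => //; exact: cf_.
  - by move=> n; exact/measurable_EFinP/measurable_funP.
  - by move=> n y _; rewrite lee_fin.
  - by move=> y _ m n mn; rewrite lee_fin; exact/lefP/nd_nnsfun_approx.
have mpE : measurable_fun setT (EFin \o p) by exact/measurable_EFinP.
have mf_ n : measurable_fun setT (fun x => (f_ n x)%:E).
  exact/measurable_EFinP/measurable_funP.
(* Multiplying by [p >= 0] keeps the approximations nonnegative and increasing, so monotone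
   convergence applies under [mu] as well. *)
transitivity (limn (fun n => \int[mu]_x ((f_ n x)%:E * (p x)%:E))); last first.
  rewrite -monotone_convergence//.
  - apply: eq_integral => y _; apply/cvg_lim => //.
    by apply: cvgeZr => //; exact: cf_.
  - by move=> n; exact: emeasurable_funM.
  - by move=> n y _; rewrite mule_ge0 ?lee_fin.
  - move=> y _ m n mn; rewrite lee_pmul ?lee_fin//.
    exact/lefP/nd_nnsfun_approx.
congr (limn _); apply/funext => n.
(* Both sides are split over the finitely many values of [f_ n], one level set at a time. *)
transitivity (\sum_(k \in range (f_ n))
    \int[nu]_x (k * \1_(f_ n @^-1` [set k]) x)%:E).
  under eq_integral do rewrite fimfunE -fsumEFin//.
  rewrite ge0_integral_fsum//.
  - by move=> y; exact/measurable_EFinP/measurable_funM.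
  - by move=> y x _; rewrite nnfun_muleindic_ge0.
transitivity (\sum_(k \in range (f_ n))
    \int[mu]_x ((k * \1_(f_ n @^-1` [set k]) x)%:E * (p x)%:E)); last first.
  rewrite -ge0_integral_fsum//.
  - apply: eq_integral => x _; rewrite [in RHS]fimfunE -fsumEFin//.
    by rewrite ge0_mule_fsuml// => y; rewrite nnfun_muleindic_ge0.
  - move=> r; apply: emeasurable_funM => //.
    exact/measurable_EFinP/measurable_funM.
  - by move=> r x _; rewrite mule_ge0 ?nnfun_muleindic_ge0 ?lee_fin.
(* Membership of [r] in the range gives [0 <= r], under which the scalar leaves both integrals. *)
apply: eq_fsbigr => r /[!inE] -[x _ rE].
have r0 : (0 <= r)%R by rewrite -rE.
under eq_integral do rewrite EFinM.
under [RHS]eq_integral do rewrite EFinM -muleA.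
rewrite ge0_integralZl//; last first.
  exact/measurable_EFinP.
rewrite ge0_integralZl//.
- congr (_ * _); rewrite integral_indic// setIT nuE//.
  rewrite integral_mkcond; apply: eq_integral => y _.
  by rewrite epatch_indic muleC.
- by apply: emeasurable_funM => //; exact/measurable_EFinP.
- by move=> y _; rewrite mule_ge0 ?lee_fin.
Qed.
End density.

(** * Second moment of the centered normal density *)

Section normal_moment.
Context {R : realType}.
Implicit Types s x : R.
Local Notation mu := (@lebesgue_measure R).

Lemma is_derive_normal_pdf s x : s != 0 ->
  is_derive x 1 (normal_pdf 0 s) (- (x / s ^+ 2) * normal_pdf 0 s x).
Proof.
move=> s0; rewrite normal_pdfE// /normal_fun.
(* The exponent, and then the density, are recast as combinations of functions whose derivatives are
   found by instance resolution. *)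
have h : is_derive x 1 (fun y : R => - (y - 0) ^+ 2 / (s ^+ 2 *+ 2))
    (- (x / s ^+ 2)).
  rewrite (_ : (fun y : R => _) = (- (s ^+ 2 *+ 2)^-1) *: (@id R ^+ 2)); last first.
    apply/funext => y; rewrite subr0 mulNr mulrC -mulNr; done.
  apply: is_derive_eq.
  rewrite /GRing.scale /= expr1 mulr1.
  by field.
have -> : (fun x0 : R => normal_peak s * expR (- (x0 - 0) ^+ 2 / (s ^+ 2 *+ 2)))
  = normal_peak s *: (expR \o (fun y : R => - (y - 0) ^+ 2 / (s ^+ 2 *+ 2))).
  by [].
apply: is_derive_eq.
rewrite /GRing.scale/=; ring.
Qed.

(** This disposes of the boundary term of the integration by parts. From [expR t >= 1 + t >= t] at
    [t = n^2 / (2 s^2)], the term is at most [C / n]. *)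
Lemma cvg_x_normal_pdf s : s != 0 ->
  (n%:R * normal_pdf 0 s n%:R) @[n --> \oo] --> (0 : R).
Proof.
move=> s0; have s20 : 0 < s ^+ 2 by rewrite exprn_even_gt0.
pose C := normal_peak s * (s ^+ 2 *+ 2).
apply: (@squeeze_cvgr _ _ _ _ (cst 0) (fun n : nat => C * n%:R^-1)).
- near=> n; have n0 : (0 : R) < n%:R.
    by rewrite ltr0n; near: n; exists 1%N.
  rewrite mulr_ge0 ?normal_pdf_ge0 ?ler0n//=.
  rewrite normal_pdfE// /normal_fun subr0 mulrCA -mulrA.
  rewrite ler_wpM2l ?normal_peak_ge0// ler_pdivlMr// mulrAC -expr2 mulNr expRN.
  rewrite ler_pdivrMr ?expR_gt0// mulrC -ler_pdivrMr ?mulrn_wgt0//.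
  by rewrite (le_trans _ (expR_ge1Dx _))// lerDr.
- exact: cvg_cst.
- rewrite -(mulr0 C); apply: cvgM; first exact: cvg_cst.
  apply/gtr0_cvgV0; last exact: cvgr_idn.
  by exists 1%N => // n /= n0; rewrite ltr0n.
Unshelve. all: end_near. Qed.

(* Integration by parts on [0, n], using (- s^2 p)' = x p for the density p. *)
Lemma integral_sqr_normal_pdf0y s : s != 0 ->
  (\int[mu]_(x in `[0%R, +oo[) (x ^+ 2 * normal_pdf 0 s x)%:E =
  (s ^+ 2)%:E * \int[mu]_(x in `[0%R, +oo[) (normal_pdf 0 s x)%:E)%E.
Proof.
move=> s0; pose p := normal_pdf 0 s.
have p0 x : 0 <= p x by exact: normal_pdf_ge0.
have cp : continuous p by exact: continuous_normal_pdf.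
have cxp : continuous (fun x : R => x * p x).
  by move=> x; apply: cvgM; [exact: cvg_id|exact: cp].
have cx2p : continuous (fun x : R => x ^+ 2 * p x).
  by move=> x; apply: cvgM; [exact: exprn_continuous|exact: cp].
have mp : measurable_fun setT p by exact: measurable_normal_pdf.
have pL := @ge0_cvgn_integral R mu p p0 mp.
have x2p0 x : 0 <= x ^+ 2 * p x by rewrite mulr_ge0// sqr_ge0.
have x2pL := @ge0_cvgn_integral R mu _ x2p0 (continuous_measurable_fun cx2p).
(* The half-line integral is the limit of the integrals over [[0, n]]; it remains to show that these
   also tend to the right-hand side. *)
apply: (cvg_unique _ x2pL); first exact: ereal_hausdorff.
have dp x := is_derive_normal_pdf x s0.
have dG x : is_derive x 1 (- s ^+ 2 *: p) (x * p x).
  by apply: is_derive_eq; rewrite /GRing.scale/= -/p; field.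
(* The endpoint [n.+1] keeps the interval nondegenerate; the shift does not affect the limit. The
   boundary term at [0] vanishes because of the factor [x]. *)
have parts n : (\int[mu]_(x in `[0%R, n.+1%:R]) (x ^+ 2 * p x)%:E =
    (- s ^+ 2 * (n.+1%:R * p n.+1%:R))%:E +
    (s ^+ 2)%:E * \int[mu]_(x in `[0%R, n.+1%:R]) (p x)%:E)%E.
  transitivity (\int[mu]_(x in `[0%R, n.+1%:R]) (x * (x * p x))%:E)%E.
    by apply: eq_integral => x _; rewrite mulrA.
  rewrite (@integration_by_parts R id (- s ^+ 2 *: p) (cst 1)
    (fun x => x * p x))//.
  - rewrite mul0r subr0.
    have -> : (n.+1%:R * (- s ^+ 2 *: p) n.+1%:R) =
      (- s ^+ 2 * (n.+1%:R * p n.+1%:R)) by rewrite mulrCA.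
    congr (_ + _)%E.
    under eq_integral => x _.
      rewrite mul1r (_ : (- s ^+ 2 *: p) x = - s ^+ 2 * p x)// EFinM. over.
    rewrite integralZl//=.
      by rewrite EFinN mulNe oppeK.
    apply: continuous_compact_integrable; first exact: segment_compact.
    exact: continuous_subspaceT.
  - exact/continuous_subspaceT/cst_continuous.
  - split.
    + by move=> x _; exact: derivable_id.
    + exact: cvg_at_right_filter.
    + exact: cvg_at_left_filter.
  - by move=> x _; rewrite derive1_id.
  - exact: continuous_subspaceT.
  - have cG : continuous (- s ^+ 2 *: p).
      move=> x; have : - s ^+ 2 *: p y @[y --> x] --> - s ^+ 2 *: p x.
        by apply: cvgM; [exact: cvg_cst|exact: cp].
      exact.
    split.
    + by move=> x _; have [] := dG x.
    + by apply: cvg_at_right_filter; exact: cG.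
    + by apply: cvg_at_left_filter; exact: cG.
  - by move=> x _; rewrite derive1E; have [_ ->] := dG x.
rewrite /= -cvg_shiftS; under eq_fun do rewrite parts.
rewrite -(add0e (_ * \int[mu]_(x in `[0%R, +oo[) _)%E); apply: cvgeD => //.
- apply: cvg_EFin; first by near=> n.
  rewrite -(mulr0 (- s ^+ 2)); apply: cvgM; first exact: cvg_cst.
  have := cvg_x_normal_pdf s0.
  by rewrite -cvg_shiftS.
- apply: cvgeZl => //.
  by have := pL; rewrite -cvg_shiftS.
Unshelve. all: end_near. Qed.

(** The integrand is even, so the integral is twice the one over the half-line. *)
Lemma integral_sqr_normal_pdf s : s != 0 ->
  (\int[mu]_x (x ^+ 2 * normal_pdf 0 s x)%:E = (s ^+ 2)%:E)%E.
Proof.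
move=> s0.
have sym x : normal_pdf 0 s x = normal_pdf 0 s (- x).
  by rewrite normal_pdfE// /normal_fun !subr0 sqrrN.
have cp : continuous (normal_pdf 0 s) by exact: continuous_normal_pdf.
have half : [set x : R | 0 <= x] = `[0, +oo[%classic.
  by apply/seteqP; split => x/=; rewrite in_itv/= andbT.
rewrite ge0_symfun_integralT//=; last 3 first.
- by move=> x; rewrite mulr_ge0 ?sqr_ge0 ?normal_pdf_ge0.
- by move=> x; apply: cvgM; [exact: exprn_continuous|exact: cp].
- by move=> x/=; rewrite sqrrN -sym.
(* The factor 2 is moved next to the half-line integral of the density, which evenness turns back
   into the total mass 1. *)
rewrite half integral_sqr_normal_pdf0y// muleCA -half -ge0_symfun_integralT//.
- by rewrite integral_normal_pdf mule1.
- by move=> x; rewrite normal_pdf_ge0.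
Qed.

End normal_moment.

(** * Moments of a real variable with prescribed law *)

Section gaussian_moments.
Context d (T : measurableType d) (R : realType) (Pr : probability T R).
Implicit Types (X : T -> R) (v : R).
Local Open Scope ereal_scope.

(** The integral is transferred to the law of [X]: a Dirac mass at 0 if [v = 0], otherwise a density
    with standard deviation [Num.sqrt v]. *)
Lemma gaussian_law_second_moment X v :
  measurable_fun setT X -> (0 <= v)%R ->
  (forall A, measurable A -> pushforward Pr X A = gaussian_law 0 v A) ->
  \int[Pr]_w (X w ^+ 2)%:E = v%:E.
Proof.
move=> mX v0 lawX.
(* [X] is retyped so that its law and Lebesgue measure live on the same measurable type. *)
have mX' : measurable_fun setT (X : T -> measurableTypeR R) by exact: mX.
pose X' : {RV Pr >-> measurableTypeR R} :=
  HB.pack (X : T -> measurableTypeR R) (isMeasurableFun.Build _ _ _ _ _ mX').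
have msqr : measurable_fun setT (fun y : measurableTypeR R => (y ^+ 2)%:E).
  by apply/measurable_EFinP; exact: measurable_funX.
have sqr0 (y : R) : 0 <= (y ^+ 2)%:E by rewrite lee_fin sqr_ge0.
rewrite -(ge0_integral_distribution X' msqr sqr0).
have [v0'|v0'] := eqVneq v 0%R.
  rewrite (@eq_measure_integral _ _ _ _ \d_(0%R : measurableTypeR R)); last first.
    by move=> A mA _; rewrite [LHS]lawX// /gaussian_law v0' eqxx.
  by rewrite integral_dirac// diracT mul1e expr0n v0'.
have s0 : Num.sqrt v != 0%R.
  by rewrite gt_eqF// sqrtr_gt0 lt_neqAle eq_sym v0'.
rewrite (@ge0_integral_density _ (measurableTypeR R) _
  (lebesgue_measure : {measure set (measurableTypeR R) -> \bar R}) _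
  (normal_pdf 0 (Num.sqrt v)))//.
- under eq_integral do rewrite -EFinM.
  by rewrite integral_sqr_normal_pdf// sqr_sqrtr.
- exact: measurable_normal_pdf.
- by move=> x; exact: normal_pdf_ge0.
- by move=> A mA; rewrite [LHS]lawX// /gaussian_law (negbTE v0').
Qed.

(** Domination by [1 + X^2], integrable because [Pr] is finite; the bound comes from
    [(|X| - 1)^2 >= 0]. *)
Lemma integrable_of_sqr X : measurable_fun setT X ->
  Pr.-integrable setT (fun w => (X w ^+ 2)%:E) ->
  Pr.-integrable setT (EFin \o X).
Proof.
move=> mX iX2.
have i1 : Pr.-integrable setT (fun w => 1%:E + (X w ^+ 2)%:E).
  by apply: integrableD => //; exact: finite_measure_integrable_cst.
apply: le_integrable i1 => //; first exact/measurable_EFinP.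
move=> w _; rewrite -EFinD /= lee_fin.
rewrite [leRHS]ger0_norm ?addr_ge0 ?sqr_ge0// -(real_normK (num_real (X w))).
by have := sqr_ge0 (`|X w| - 1)%R; rewrite sqrrB1 => ?; nra.
Qed.

Lemma gaussian_law_integrable_sqr X v :
  measurable_fun setT X -> (0 <= v)%R ->
  (forall A, measurable A -> pushforward Pr X A = gaussian_law 0 v A) ->
  Pr.-integrable setT (fun w => (X w ^+ 2)%:E).
Proof.
move=> mX v0 lawX; apply/integrableP; split.
  by apply/measurable_EFinP; exact: measurable_funX.
under eq_integral => w _ do rewrite gee0_abs ?lee_fin ?sqr_ge0//.
by rewrite (gaussian_law_second_moment mX v0 lawX) ltry.
Qed.

(** The mean depends only on the law, so it equals its own opposite; integrability makes it a real
    number, hence 0. *)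
Lemma symmetric_law_mean0 X :
  Pr.-integrable setT (EFin \o X) ->
  (forall A, measurable A ->
    pushforward Pr X A = pushforward Pr (\- X)%R A) ->
  \int[Pr]_w (X w)%:E = 0.
Proof.
move=> iX symX.
have mX : measurable_fun setT X by apply/measurable_EFinP; exact: measurable_int iX.
have mNX : measurable_fun setT (\- X)%R by exact: measurableT_comp.
have iNX : Pr.-integrable setT (EFin \o (\- X)%R).
  by have := integrableN iX; apply: eq_integrable.
pose X' : {RV Pr >-> R} := HB.pack X (isMeasurableFun.Build _ _ _ _ X mX).
pose Y' : {RV Pr >-> R} := HB.pack (\- X)%R (isMeasurableFun.Build _ _ _ _ _ mNX).
have E1 : \int[distribution Pr X']_y y%:E = \int[Pr]_w (X w)%:E.
  by rewrite integral_distribution//; exact/measurable_EFinP.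
have E2 : \int[distribution Pr Y']_y y%:E = \int[Pr]_w (- X w)%:E.
  by rewrite integral_distribution//; exact/measurable_EFinP.
have EN : \int[Pr]_w (- X w)%:E = - \int[Pr]_w (X w)%:E.
  by under eq_integral do rewrite EFinN; rewrite integralN// integrable_add_def.
have : \int[Pr]_w (X w)%:E = - \int[Pr]_w (X w)%:E.
  rewrite -EN -E1 -E2; apply: eq_measure_integral => A mA _; exact: symX.
have := integrable_fin_num measurableT iX; rewrite /comp.
case: (\int[Pr]_w _) => // r _; rewrite -EFinN => -[] r0; congr EFin; lra.
Qed.

End gaussian_moments.

(** * Real and imaginary parts of complex matrix products *)

Section complex_matrices.
Local Open Scope sesquilinear_scope.
Context {R : realType}.
Local Notation Re := (@complex.Re R).
Local Notation Im := (@complex.Im R).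
Local Notation mxRe := (map_mx Re).
Local Notation mxIm := (map_mx Im).

Lemma ReD (x y : R[i]) : Re (x + y) = Re x + Re y.
Proof. by case: x y => [a b] [c d]. Qed.

Lemma ImD (x y : R[i]) : Im (x + y) = Im x + Im y.
Proof. by case: x y => [a b] [c d]. Qed.

Lemma ReM (x y : R[i]) : Re (x * y) = Re x * Re y - Im x * Im y.
Proof. by case: x y => [a b] [c d]. Qed.

Lemma ImM (x y : R[i]) : Im (x * y) = Re x * Im y + Im x * Re y.
Proof. by case: x y => [a b] [c d]. Qed.

Lemma sqr_normcE (x : R[i]) : Normc.normc x ^+ 2 = Re x ^+ 2 + Im x ^+ 2.
Proof. by case: x => a b; rewrite sqr_sqrtr// addr_ge0 ?sqr_ge0. Qed.

Lemma Re_mulmx m n p (A : 'M[R[i]]_(m, n)) (B : 'M[R[i]]_(n, p)) :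
  mxRe (A *m B) = mxRe A *m mxRe B - mxIm A *m mxIm B.
Proof.
apply/matrixP => i j; rewrite !mxE (big_morph Re ReD (erefl _)) -sumrB.
by apply: eq_bigr => k _; rewrite ReM !mxE.
Qed.

Lemma Im_mulmx m n p (A : 'M[R[i]]_(m, n)) (B : 'M[R[i]]_(n, p)) :
  mxIm (A *m B) = mxRe A *m mxIm B + mxIm A *m mxRe B.
Proof.
apply/matrixP => i j; rewrite !mxE (big_morph Im ImD (erefl _)) -big_split.
by apply: eq_bigr => k _; rewrite ImM !mxE.
Qed.

Lemma Re_adjmx m n (A : 'M[R[i]]_(m, n)) : mxRe (A ^t* ) = (mxRe A)^T.
Proof. by apply/matrixP => i j; rewrite !mxE; case: (A j i). Qed.

Lemma Im_adjmx m n (A : 'M[R[i]]_(m, n)) : mxIm (A ^t* ) = - (mxIm A)^T.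
Proof. by apply/matrixP => i j; rewrite !mxE; case: (A j i). Qed.

(** The same stacking as in [circular_complex_normal], used here both for the random vector and for
    the coefficients of its linear forms. *)
Definition stack_real n (b : 'cV[R[i]]_n) : 'cV[R]_(n + n) :=
  col_mx (mxRe b) (mxIm b).

(** Conjugating [h] cancels the minus sign of the product of imaginary parts. The coefficients [b]
    are put on the left, as in [normal_vector]. *)
Lemma Re_inner_stack_real n (h b : 'cV[R[i]]_n) :
  Re ((h ^t* *m b) 0 0) = ((stack_real b)^T *m stack_real h) 0 0.
Proof.
transitivity (mxRe (h ^t* *m b) 0 0); first by rewrite [RHS]mxE.
rewrite Re_mulmx Re_adjmx Im_adjmx mulNmx opprK. rewrite /stack_real tr_col_mx mul_row_col.
have dotC (u v : 'cV[R]_n) : (u^T *m v) 0 0 = (v^T *m u) 0 0.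
  by rewrite -[u^T *m v]trmxK trmx_mul trmxK mxE.
by rewrite [LHS]mxE [RHS]mxE dotC; congr (_ + _); exact: dotC.
Qed.

(** The block matrix is the real form of multiplication by [C]: it sends [stack_real b] to the
    stacking of [C *m b]. *)
Lemma Re_hform_stack_real n (C : 'M[R[i]]_n) (b : 'cV[R[i]]_n) :
  ((stack_real b)^T
     *m block_mx (mxRe C) (- mxIm C) (mxIm C) (mxRe C) *m stack_real b) 0 0
  = Re (hform C b).
Proof.
transitivity (mxRe (b ^t* *m C *m b) 0 0); last by rewrite [LHS]mxE.
rewrite !(Re_mulmx, Im_mulmx) Re_adjmx Im_adjmx /stack_real tr_col_mx.
rewrite mul_row_block mul_row_col.
congr (fun_of_matrix _ 0 0).
by rewrite !mulmxDl !mulNmx !mulmxN; do ?rewrite (opprK, opprD, mulNmx, addrA).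
Qed.

Lemma hformZ n (C : 'M[R[i]]_n) (k : R[i]) (b : 'cV[R[i]]_n) :
  hform C (k *: b) = (Normc.normc k ^+ 2)%:C * hform C b.
Proof.
rewrite /hform.
have -> : (k *: b) ^t* = k^* *: b ^t*.
  by apply/matrixP => i j; rewrite !mxE rmorphM.
rewrite -!scalemxAl -scalemxAr !mxE mulrA; congr (_ * _).
by rewrite mulrC -normCK normc_def -rmorphXn sqr_normcE sqr_sqrtr ?addr_ge0 ?sqr_ge0.
Qed.

(** Serves for three scalars: [-1] (symmetry of the law), [- 'i] (imaginary parts) and [expj phi1]
    (the phase). *)
Lemma hform_unit n (C : 'M[R[i]]_n) (k : R[i]) (b : 'cV[R[i]]_n) :
  Normc.normc k ^+ 2 = 1 -> hform C (k *: b) = hform C b.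
Proof. by move=> k1; rewrite hformZ k1 mul1r. Qed.

Lemma hform_delta n (C : 'M[R[i]]_n) i : hform C (delta_mx i 0) = C i i.
Proof.
rewrite /hform -colE.
have -> : (delta_mx i 0 : 'cV[R[i]]_n) ^t* = delta_mx 0 i.
  by apply/matrixP => j k; rewrite !mxE; case: eqP; case: eqP; rewrite ?rmorph1 ?rmorph0.
by rewrite -rowE !mxE.
Qed.

(** The inner product with a basis vector is the conjugate of a coordinate, with the same modulus;
    the norm thus falls under the moments of inner products. *)
Lemma sqr_enorm n (h : 'cV[R[i]]_n) :
  enorm h ^+ 2 = \sum_i Normc.normc ((h ^t* *m (delta_mx i 0 : 'cV_n)) 0 0) ^+ 2.
Proof.
rewrite sqr_sqrtr; last by apply: sumr_ge0 => i _; rewrite sqr_ge0.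
apply: eq_bigr => i _; rewrite -colE !mxE !sqr_normcE.
by case: (h i 0) => a b /=; rewrite sqrrN.
Qed.

Lemma normc_expj (t : R) : Normc.normc (expj t) = 1.
Proof. by rewrite /expj/= cos2Dsin2 sqrtr1. Qed.

End complex_matrices.

(** * Moments of inner products with a circular complex Gaussian vector *)

Section circular_complex_normal_moments.
Local Open Scope sesquilinear_scope.
Context d (T : measurableType d) (R : realType) (Pr : probability T R).
Context n (C : 'M[R[i]]_n) (h : T -> 'cV[R[i]]_n).
Hypotheses (psdC : psdmx C) (hC : circular_complex_normal Pr h C).

Let inner (b : 'cV[R[i]]_n) (w : T) : R[i] := (h w ^t* *m b) 0 0.

Let scalemx00 (K : pzRingType) (k : K) (A : 'M[K]_1) : (k *: A) 0 0 = k * A 0 0.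
Proof. by rewrite mxE. Qed.

Lemma Re_hform_ge0 b : 0 <= complex.Re (hform C b).
Proof. by case: psdC => _ /(_ b); rewrite lecE/= => /andP[]. Qed.

Lemma measurable_Re_inner b :
  measurable_fun setT (fun w => complex.Re (inner b w)).
Proof.
case: hC => mh _; rewrite (_ : (fun w => _) = fun w =>
    \sum_i (stack_real b)^T 0 i * stack_real (h w) i 0); last first.
  by apply/funext => w; rewrite /inner Re_inner_stack_real mxE.
apply: measurable_sum => i; apply: measurable_funM => //; exact: mh.
Qed.

(** The Gaussian hypothesis is applied to the coefficients [stack_real b]; the division by 2 is the
    factor [2^-1] of the stacked covariance. *)
Lemma Re_inner_law b A : measurable A ->
  pushforward Pr (fun w => complex.Re (inner b w)) A =
  gaussian_law 0 (complex.Re (hform C b) / 2) A.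
Proof.
move=> mA; case: hC => _ /(_ (stack_real b) A mA).
rewrite mulmx0 [in X in gaussian_law X]mxE.
rewrite -scalemxAr -scalemxAl scalemx00 Re_hform_stack_real mulrC => <-.
by congr (pushforward Pr _ A); apply/funext => w; rewrite /inner Re_inner_stack_real.
Qed.

Let var_ge0 b : 0 <= complex.Re (hform C b) / 2.
Proof. by rewrite divr_ge0 ?Re_hform_ge0. Qed.

Lemma integrable_sqr_Re_inner b :
  Pr.-integrable setT (fun w => (complex.Re (inner b w) ^+ 2)%:E).
Proof.
exact: gaussian_law_integrable_sqr (measurable_Re_inner b) (var_ge0 b)
  (Re_inner_law b).
Qed.

Lemma integrable_Re_inner b :
  Pr.-integrable setT (fun w => (complex.Re (inner b w))%:E).
Proof.
exact: integrable_of_sqr (measurable_Re_inner b) (integrable_sqr_Re_inner b).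
Qed.

Lemma integral_Re_inner b : (\int[Pr]_w (complex.Re (inner b w))%:E = 0)%E.
Proof.
apply: symmetric_law_mean0; first exact: integrable_Re_inner.
move=> A mA; rewrite Re_inner_law//.
(* The opposite variable is again of the form [Re (inner _ w)], for the vector [-b], whose quadratic
   form is that of [b]. *)
have -> : (\- (fun w => complex.Re (inner b w)))%R =
    fun w => complex.Re (inner ((-1) *: b) w).
  apply/funext => w; rewrite /inner -scalemxAr scalemx00 ReM/=.
  by rewrite oppr0 mul0r subr0 mulN1r.
rewrite (Re_inner_law _ mA) hform_unit//.
by rewrite sqr_normcE /= sqrrN oppr0 expr1n expr0n addr0.
Qed.

(* Im(h^H b) = Re(h^H (-i b)), and -i b has the same quadratic form as b. *)
Let sqr_normc_inner b w : Normc.normc (inner b w) ^+ 2 =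
  complex.Re (inner b w) ^+ 2 + complex.Re (inner (- 'i *: b) w) ^+ 2.
Proof.
rewrite sqr_normcE; congr (_ + _ ^+ 2).
rewrite /inner -scalemxAr scalemx00 ReM /=; ring.
Qed.

Let hform_Ni b : hform C (- 'i *: b) = hform C b.
Proof.
by apply: hform_unit; rewrite sqr_normcE /= oppr0 sqrrN expr1n expr0n add0r.
Qed.

Lemma integrable_sqr_normc_inner b :
  Pr.-integrable setT (fun w => (Normc.normc (inner b w) ^+ 2)%:E).
Proof.
under eq_fun do rewrite sqr_normc_inner EFinD.
by apply: integrableD => //; exact: integrable_sqr_Re_inner.
Qed.

(** The real and imaginary parts each contribute half of the quadratic form. *)
Lemma integral_sqr_normc_inner b :
  (\int[Pr]_w (Normc.normc (inner b w) ^+ 2)%:E = (complex.Re (hform C b))%:E)%E.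
Proof.
under eq_integral do rewrite sqr_normc_inner EFinD.
rewrite integralD//; do ?exact: integrable_sqr_Re_inner.
have E c := gaussian_law_second_moment (measurable_Re_inner c) (var_ge0 c)
  (Re_inner_law c).
by rewrite !E hform_Ni -EFinD -splitr.
Qed.

Lemma integrable_sqr_enorm : Pr.-integrable setT (fun w => (enorm (h w) ^+ 2)%:E).
Proof.
under eq_fun do rewrite sqr_enorm -sumEFin.
by apply: integrable_sum => // i _; exact: integrable_sqr_normc_inner.
Qed.

Lemma integral_sqr_enorm :
  (\int[Pr]_w (enorm (h w) ^+ 2)%:E = (complex.Re (\tr C))%:E)%E.
Proof.
under eq_integral do rewrite sqr_enorm -sumEFin.
rewrite integral_sum//; last by move=> i; exact: integrable_sqr_normc_inner.
under eq_bigr do rewrite integral_sqr_normc_inner hform_delta.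
by rewrite sumEFin (big_morph (@complex.Re R) (@ReD R) (erefl _)).
Qed.

End circular_complex_normal_moments.

(** * Expectation of affine combinations and the average SNRs *)

Lemma expectation_affine3 d (T : measurableType d) (R : realType)
    (Pr : probability T R) (X Y Z : T -> R) (x y z c0 c1 c2 c3 : R) :
  Pr.-integrable setT (EFin \o X) -> Pr.-integrable setT (EFin \o Y) ->
  Pr.-integrable setT (EFin \o Z) ->
  (\int[Pr]_w (X w)%:E = x%:E)%E -> (\int[Pr]_w (Y w)%:E = y%:E)%E ->
  (\int[Pr]_w (Z w)%:E = z%:E)%E ->
  ('E_Pr [fun w => (c0 + c1 * X w + c2 * Y w + c3 * Z w)%R])%E
  = (c0 + c1 * x + c2 * y + c3 * z)%:E.
Proof.
move=> iX iY iZ Ex Ey Ez; rewrite unlock.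
have ic : Pr.-integrable setT (fun=> c0%:E) by exact: finite_measure_integrable_cst.
have iZl c W : Pr.-integrable setT (EFin \o W) ->
    Pr.-integrable setT (fun w => c%:E * (W w)%:E)%E.
  by move=> iW; exact: integrableZl.
under eq_integral do rewrite !EFinD !EFinM.
rewrite !integralD ?integralZl ?Ex ?Ey ?Ez//; do ?apply: integrableD => //;
  do ?exact: iZl.
by rewrite integral_cst// [X in (_ * X)%E]probability_setT mule1.
Qed.

Theorem mainTheorem14 (R : realType) (d : measure_display)
    (T : measurableType d) (Pr : probability T R)
    (M N : nat) (hM : (1 <= M)%N) (hN : (1 <= N)%N)
    (P sigma beta1 beta2 beta3 alphaARIS alphaNCR : R)
    (hP : 0 < P) (hsigma : 0 < sigma ^+ 2)
    (hbeta1 : 0 < beta1) (hbeta2 : 0 < beta2) (hbeta3 : 0 < beta3)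
    (halphaARIS : 0 < alphaARIS) (halphaNCR : 0 < alphaNCR)
    (phi1 : R)
    (a21 : 'cV[R[i]]_M) (ha21 : forall i, `|a21 i 0| = 1)
    (R3 : 'M[R[i]]_M) (hR3 : psdmx R3) (htr : \tr R3 = (M%:R * beta3)%:C)
    (h3 : T -> 'cV[R[i]]_M) (hh3 : circular_complex_normal Pr h3 R3) :
  [/\ ('E_Pr [fun w => SNR_PRIS N P sigma beta1 beta2 phi1 a21 (h3 w)] =
        (P * (beta3 * M%:R + beta1 * beta2 * N%:R ^+ 2 * M%:R)
         / sigma ^+ 2)%:E)%E,
      ('E_Pr [fun w => SNR_ARIS N P sigma beta1 beta2 alphaARIS phi1 a21 (h3 w)] =
        ((P * alphaARIS ^+ 2 * M%:R * beta1 * beta2 * N%:R ^+ 2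
          - P * alphaARIS ^+ 2 * beta2 * N%:R * complex.Re (hform R3 a21))
         / (sigma ^+ 2 * (1 + alphaARIS ^+ 2 * beta2 * M%:R * N%:R))
         + P * beta3 * M%:R / sigma ^+ 2)%:E)%E
    & ('E_Pr [fun w => SNR_NCR P sigma beta1 beta2 alphaNCR phi1 a21 (h3 w)] =
        ((P * alphaNCR ^+ 2 * M%:R * beta1 * beta2
          - P * alphaNCR ^+ 2 * beta2 * complex.Re (hform R3 a21))
         / (sigma ^+ 2 * (1 + alphaNCR ^+ 2 * beta2 * M%:R))
         + P * beta3 * M%:R / sigma ^+ 2)%:E)%E].
Proof.
(* The phase is absorbed into the vector, which makes [x] a plain inner product with [h3]. *)
pose b := expj phi1 *: a21.
have xE w : cross_gain a21 phi1 (h3 w) = ((h3 w ^t* *m b)%sesqui 0 0).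
  by rewrite /b -scalemxAr [in RHS]mxE mulrC.
have iX := integrable_Re_inner hR3 hh3 b.
have iY := integrable_sqr_normc_inner hR3 hh3 b.
have iZ := integrable_sqr_enorm hR3 hh3.
have EX := integral_Re_inner hR3 hh3 b.
(* Since the phase has modulus 1, it disappears from the quadratic form and [a21] alone remains. *)
have EY : (\int[Pr]_w (Normc.normc ((h3 w ^t* *m b)%sesqui 0 0) ^+ 2)%:E =
    (complex.Re (hform R3 a21))%:E)%E.
  rewrite (integral_sqr_normc_inner hR3 hh3 b) hform_unit//.
  by rewrite normc_expj expr1n.
have EZ : (\int[Pr]_w (enorm (h3 w) ^+ 2)%:E = (M%:R * beta3)%:E)%E.
  by rewrite (integral_sqr_enorm hR3 hh3) htr.
have E := expectation_affine3 _ _ _ _ iX iY iZ EX EY EZ.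
have s0 : sigma != 0 by apply: contraTneq hsigma => ->; rewrite expr0n ltxx.
have dA : 1 + alphaARIS ^+ 2 * beta2 * M%:R * N%:R != 0.
  by rewrite gt_eqF// ltr_pwDl// !mulr_ge0// ?sqr_ge0// ltW.
have dN : 1 + alphaNCR ^+ 2 * beta2 * M%:R != 0.
  by rewrite gt_eqF// ltr_pwDl// !mulr_ge0// ?sqr_ge0// ltW.
split.
(* The arguments of [E] are the coefficients of 1, [Re x], [|x|^2] and the squared norm of [h3]; the
   third is 0 for the passive surface. *)
- have := E (P / sigma ^+ 2 * (beta1 * beta2 * N%:R ^+ 2 * M%:R))
    (P / sigma ^+ 2 * (2 * Num.sqrt (beta1 * beta2) * N%:R)) 0 (P / sigma ^+ 2).
  rewrite (_ : (fun w => _) = (fun w => SNR_PRIS N P sigma beta1 beta2 phi1 a21 (h3 w))).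
    by move=> ->; congr EFin; field.
  by apply/funext => w; rewrite /SNR_PRIS xE; ring.
(* [D] is deterministic, so dividing by it keeps the SNR affine in the three random quantities. *)
- pose D := sigma ^+ 2 * (1 + alphaARIS ^+ 2 * beta2 * M%:R * N%:R).
  have := E (P * alphaARIS ^+ 2 * M%:R * beta1 * beta2 * N%:R ^+ 2 / D)
    (2 * P * alphaARIS * N%:R * Num.sqrt (beta1 * beta2) / D)
    (- (P * alphaARIS ^+ 2 * beta2 * N%:R) / D) (P / sigma ^+ 2).
  rewrite (_ : (fun w => _) =
      (fun w => SNR_ARIS N P sigma beta1 beta2 alphaARIS phi1 a21 (h3 w))).
    by move=> ->; congr EFin; rewrite /D; field; rewrite dA s0.
  by apply/funext => w; rewrite /SNR_ARIS xE -/D; ring.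
- pose D := sigma ^+ 2 * (1 + alphaNCR ^+ 2 * beta2 * M%:R).
  have := E (P * alphaNCR ^+ 2 * M%:R * beta1 * beta2 / D)
    (2 * P * alphaNCR * Num.sqrt (beta1 * beta2) / D)
    (- (P * alphaNCR ^+ 2 * beta2) / D) (P / sigma ^+ 2).
  rewrite (_ : (fun w => _) =
      (fun w => SNR_NCR P sigma beta1 beta2 alphaNCR phi1 a21 (h3 w))).
    by move=> ->; congr EFin; rewrite /D; field; rewrite dN s0.
  by apply/funext => w; rewrite /SNR_NCR xE -/D; ring.
Qed.
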